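(* Let $n\ge 1$, let $N$ be a multiplicative, unitarily invariant, self-adjoint norm on $\mathbb{M}_n$, and let $\alpha_1,\alpha_2\in[0,\pi/2)$. If $X=[x_{ij}]\in\mathbb{M}^s_{n,\alpha_1}$ and $Y=[y_{ij}]\in\mathbb{M}^s_{n,\alpha_2}$, then $$\omega_N(X\circ Y)\le \sec(\alpha_1)\sec(\alpha_2)\,\max_{j}|x_{jj}|\,\omega_N(Y)$$ and $$\omega_N(X\circ Y)\le \sec(\alpha_1)\sec(\alpha_2)\,\max_{j}|y_{jj}|\,\omega_N(X).$$
   Context: $\mathbb{M}_n$ is the algebra of $n\times n$ complex matrices, and $X\circ Y=[x_{ij}y_{ij}]$ is the Hadamard product of $X=[x_{ij}]$ and $Y=[y_{ij}]$. A norm $N$ on $\mathbb{M}_n$ is multiplicative if $N(XY)\le N(X)N(Y)$ (ordinary matrix product) for all $X,Y\in\mathbb{M}_n$; unitarily invariant if $N(UXV)=N(X)$ for all $X\in\mathbb{M}_n$ and all unitary $U,V\in\mathbb{M}_n$; self-adjoint if $N(X^* )=N(X)$ for all $X$. With $\operatorname{Re}(X)=\frac{X+X^*}{2}$, the generalized numerical radius induced by $N$ is $\omega_N(X)=\sup_{\theta\in\mathbb{R}}N(\operatorname{Re}(e^{i\theta}X))$. The numerical range of $X$ is $W(X)=\{\langle Xx,x\rangle: x\in\mathbb{C}^n,\ \|x\|=1\}$. For $\alpha\in[0,\pi/2)$, $S_\alpha=\{x+iy\in\mathbb{C}: x>0,\ |y|\le \tan(\alpha)\,x\}$, and $\mathbb{M}^s_{n,\alpha}$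 is the class of all $X\in\mathbb{M}_n$ for which there is a complex number $z$ with $|z|=1$ and $W(zX)\subset S_\alpha$. *)

(* Defs.v *)
From HB Require Import structures.
From mathcomp Require Import all_boot all_order all_algebra.
From mathcomp Require Import sesquilinear spectral complex.
From mathcomp Require Import all_classical all_reals all_analysis.

Set Implicit Arguments.
Unset Strict Implicit.
Unset Printing Implicit Defensive.

Import Order.TTheory GRing.Theory Num.Theory.

Local Open Scope classical_set_scope.
Local Open Scope ring_scope.
Local Open Scope complex_scope.
Local Open Scope sesquilinear_scope.

Definition sec {R : realType} (t : R) : R := (cos t)^-1.

Definition expi {R : realType} (t : R) : R[i] := cos t +i* sin t.

(* The norm `|z| of the library lives in R[i]; the modulus below is R-valued. *)
Definition modulus {R : realType} (z : R[i]) : R := ComplexField.Normc.normc z.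

Section Matrices.
Variables (R : realType) (n : nat).
Implicit Types (X Y : 'M[R[i]]_n) (x y : 'cV[R[i]]_n) (N : 'M[R[i]]_n -> R).

Definition hadamard X Y : 'M[R[i]]_n := \matrix_(i, j) (X i j * Y i j).

(* dotmx is defined on row vectors, hence the transpositions; it is linear in
   its first argument. *)
Definition inner x y : R[i] := dotmx x^T y^T.

Definition enorm x : R[i] := sqrtC (inner x x).

Definition remx X : 'M[R[i]]_n := 2^-1 *: (X + X^t*).

Record is_norm N : Prop := IsNorm {
  norm_ge0 : forall X, 0 <= N X ;
  norm_eq0_inv : forall X, N X = 0 -> X = 0 ;
  norm_scale : forall (c : R[i]) X, N (c *: X) = modulus c * N X ;
  norm_triangle : forall X Y, N (X + Y) <= N X + N Y }.

Definition norm_multiplicative N : Prop :=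
  forall X Y, N (X *m Y) <= N X * N Y.

Definition norm_unitarily_invariant N : Prop :=
  forall X (U V : 'M[R[i]]_n), U \is unitarymx -> V \is unitarymx ->
    N (U *m X *m V) = N X.

Definition norm_selfadjoint N : Prop := forall X, N (X^t*) = N X.

(* When N is a norm the set is bounded, by (N X + N X^t* ) / 2, so that [sup]
   is a genuine supremum. *)
Definition gen_numradius N X : R :=
  sup (range (fun t : R => N (remx (expi t *: X)))).

Definition numrange X : set R[i] :=
  [set inner (X *m x) x | x in [set x : 'cV[R[i]]_n | enorm x = 1]].

Definition sector (a : R) : set R[i] :=
  [set z | 0 < complex.Re z /\ `|complex.Im z| <= tan a * complex.Re z].

Definition sectorial (a : R) : set 'M[R[i]]_n :=
  [set X | exists z : R[i], modulus z = 1 /\ numrange (z *: X) `<=` sector a].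

(* The default value 0 is harmless for n > 0, the moduli being nonnegative. *)
Definition maxdiag X : R := \big[Num.max/0]_(j < n) modulus (X j j).

End Matrices.

(* Main.v *)
(* A matrix X with W(X) in the sector S_a is z1 P1 + z2 P2 with P1, P2 positive
   semidefinite, z1, z2 unimodular, and P1 + P2 = sec(a) Re X. By the Schur product
   theorem X o Y is then a sum of four unimodular multiples of positive
   semidefinite matrices, whence, with A = Re X and B = Re Y,
     |<(X o Y) v, u>|
       <= sec(a1) sec(a2) (<(A o B) u, u> + <(A o B) v, v>) / 2.
   Taking for u, v the singular vectors of X o Y and diagonalising B, the singular
   values of X o Y are at most sec(a1) sec(a2) max_j a_jj times the image of the
   eigenvalues of B under a doubly substochastic matrix. A unitarily invariant norm
   of a nonnegative diagonal matrix decreases under such maps, by weak majorization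
   and T-transforms; so N(X o Y) is at most that constant times N(Re Y). Finally
   omega_N(X o Y) <= N(X o Y), and N(Re Y) <= omega_N(Y) after normalising Y by a
   phase. *)

Require Import Defs.
From mathcomp Require Import all_boot all_order all_algebra.
From mathcomp Require Import fingroup perm sesquilinear spectral complex.
From mathcomp Require Import all_classical all_reals all_analysis.
From mathcomp Require Import ring lra.
Import Order.TTheory GRing.Theory Num.Theory.

Set Implicit Arguments.
Unset Strict Implicit.
Unset Printing Implicit Defensive.

Local Open Scope classical_set_scope.
Local Open Scope ring_scope.
Local Open Scope complex_scope.
Local Open Scope sesquilinear_scope.

(** * Weak majorization *)

Lemma seq_max_exists {R : realDomainType} (s : seq R) : s != [::] ->
  exists2 x, x \in s & {in s, forall y, y <= x}.
Proof.
elim: s => // x [_ _|y s IHs _].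
  by exists x; rewrite ?mem_head // => y; rewrite inE => /eqP->.
have [//|z zs zP] := IHs.
have [zx|/ltW xz] := leP z x.
  exists x; first exact: mem_head.
  by move=> w; rewrite inE => /predU1P[->//|/zP/le_trans->].
exists z; first by rewrite inE zs orbT.
by move=> w; rewrite inE => /predU1P[->//|/zP].
Qed.

Lemma seq_min_exists {R : realDomainType} (s : seq R) : s != [::] ->
  exists2 x, x \in s & {in s, forall y, x <= y}.
Proof.
move=> s0; have [|x /mapP[y ys ->] yP] := @seq_max_exists R (map -%R s).
  by case: s s0.
by exists y => // z zs; rewrite -lerN2 yP // map_f.
Qed.

Section WeakMajorization.
Context {R : realFieldType}.
Implicit Types (s t b : seq R) (c : R).

Definition excess c s : R := \sum_(x <- s) Num.max (x - c) 0.

(** For nonnegative sequences of equal length this is equivalent to comparing the partial sums of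
    the decreasing rearrangements; truncated sums avoid sorting. *)
Definition weakly_majorized t b : Prop :=
  forall c, 0 <= c -> excess c t <= excess c b.

Lemma excess_cons c x s : excess c (x :: s) = Num.max (x - c) 0 + excess c s.
Proof. by rewrite /excess big_cons. Qed.

Lemma excess_perm c s s' : perm_eq s s' -> excess c s = excess c s'.
Proof. by move=> ss'; apply: perm_big. Qed.

Lemma excess_eq0 c s : {in s, forall x, x <= c} -> excess c s = 0.
Proof.
move=> sc; rewrite /excess big_seq big1 // => x /sc xc.
by apply/max_idPr; rewrite subr_le0.
Qed.

Lemma excess_ge0 c s : 0 <= excess c s.
Proof. by apply: sumr_ge0 => x _; rewrite le_max lexx orbT. Qed.

Lemma excess_le_count (c d : R) s : c <= d -> {in s, forall x, x <= d} ->
  excess c s <= (count (> c) s)%:R * (d - c).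
Proof.
move=> cd; elim: s => [|x s IHs] sd.
  by rewrite /excess big_nil mul0r.
have xd : x <= d by apply: sd; exact: mem_head.
have /IHs le_s : {in s, forall y, y <= d}.
  by move=> y ys; apply: sd; rewrite inE ys orbT.
rewrite excess_cons /= natrD mulrDl lerD //.
by case: (ltP c x) => xc /=; rewrite ?mul1r ?mul0r ge_max; apply/andP; split; lra.
Qed.

Lemma excess_shift (c d : R) s : c <= d ->
  excess d s + (count (> d) s)%:R * (d - c) <= excess c s.
Proof.
move=> cd; elim: s => [|x s IHs].
  by rewrite /excess !big_nil mul0r addr0.
rewrite !excess_cons /= natrD mulrDl addrACA lerD //.
case: (ltP d x) => xd /=; rewrite ?mul1r ?mul0r.
  by rewrite (max_idPl _) ?subr_ge0 ?(ltW xd)// le_max; apply/orP; left; lra.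
by rewrite (max_idPr _) ?subr_le0// addr0 le_max lexx orbT.
Qed.

(** With no entry strictly between [c] and [p], the excess is affine in the level there, with slope
    minus the number of entries that are at least [p]. *)
Lemma count_le_excess (c d p : R) s : c <= d -> d < p ->
  {in s, forall x, x <= c \/ p <= x} ->
  (count (>= p) s)%:R * (p - d) <= excess d s /\
  excess d s = excess c s - (count (>= p) s)%:R * (d - c).
Proof.
move=> cd dp; elim: s => [|x s IHs] sP.
  by rewrite /excess !big_nil !mul0r subr0.
have [|IH1 IH2] := IHs; first by move=> y ys; apply: sP; rewrite inE ys orbT.
rewrite !excess_cons /= natrD !mulrDl.
have [xc|px] := sP x (mem_head _ _).
  rewrite [p <= x]leNgt (le_lt_trans xc) ?(le_lt_trans cd)//= !mul0r !add0r.
  rewrite !(max_idPr _) ?subr_le0// ?(le_trans xc)// !add0r.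
  by split.
rewrite px /= !mul1r.
by rewrite !(max_idPl _) ?subr_ge0; [split; lra| lra | lra].
Qed.

(* Removing a largest entry [a] of [t], and replacing the neighbours [q < a <= p]
   of [a] in [b] by their T-transform [p + q - a] (the other value being [a]).
   For [q < d < a] the bound rests on an integrality argument: count the entries
   of [t] above [d] against those of [b] above [a]. *)
Lemma weakly_majorized_transfer (a p q : R) t b : 0 <= q -> q < a -> a <= p ->
  {in t, forall x, x <= a} -> {in b, forall x, x <= q \/ p <= x} ->
  weakly_majorized (a :: t) (p :: q :: b) ->
  weakly_majorized t ((p + q - a) :: b).
Proof.
move=> q0 qa ap ta bP maj d d0; have := maj d d0; rewrite !excess_cons.
have [ad _|da] := leP a d.
  rewrite excess_eq0 => [|x /ta xa]; last exact: le_trans xa ad.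
  by rewrite addr_ge0 ?excess_ge0// le_max lexx orbT.
have eq0 : 0 <= p - d by lra.
rewrite (max_idPl eq0) [Num.max (a - d) 0](max_idPl _) ?subr_ge0 ?(ltW da)//.
have [dq|qd] := leP d q.
  rewrite (max_idPl _) ?subr_ge0// (max_idPl _); last by lra.
  by lra.
move=> _; have := maj q q0; rewrite !excess_cons subrr maxxx add0r.
rewrite (max_idPl _); last by lra.
rewrite (max_idPl _); last by lra.
have [bd1 bd2] := count_le_excess (ltW qd) (lt_le_trans da ap) bP.
have := excess_shift t (ltW qd).
have := excess_le_count (ltW da) ta.
set r := count _ t; set m := count _ b in bd1 bd2 => tr shift majq.
set e := Num.max _ _; have e0 : 0 <= e by rewrite le_max lexx orbT.
have e1 : p + q - a - d <= e by rewrite le_max lexx.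
(* If [r <= m], the excess of [t] at [d] is at most [r (a - d) <= m (p - d)], hence at most that of
   [b]. Otherwise [r >= m + 1]: from level [q] to [d] the excess of [t] drops by at least
   [(m + 1) (d - q)], that of [b] by exactly [m (d - q)], and the surplus [d - q] turns the slack
   [p - a] into [p + q - a - d]. *)
have [rm|mr] := leqP r m.
  have : r%:R * (a - d) <= m%:R * (p - d) by rewrite ler_pM ?ler_nat//; lra.
  by lra.
have : m.+1%:R * (d - q) <= r%:R * (d - q) by rewrite ler_wpM2r ?ler_nat//; lra.
by rewrite -natr1 mulrDl mul1r; lra.
Qed.

(* [g] plays the role of [s |-> N (diag s)]: a symmetric gauge, seen only through
   the three properties that the T-transform argument needs. *)
Section Dominance.
Variables (n : nat) (g : seq R -> R).
Hypothesis g_perm : forall s s', size s = n -> perm_eq s s' -> g s = g s'.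
Hypothesis g_mono : forall (x y : R) s, 0 <= x <= y -> (size s).+1 = n ->
  g (x :: s) <= g (y :: s).
Hypothesis g_transfer : forall (p q x : R) s, q <= x <= p -> (size s).+2 = n ->
  g (x :: p + q - x :: s) <= g (p :: q :: s).

(** Entries are raised one at a time, each permuted to the head where [g_mono] applies; [pre] holds
    those already raised. *)
Lemma dominance_pointwise pre t b :
    size t = size b -> (size pre + size t = n)%N ->
    (forall i, (i < size t)%N -> 0 <= t`_i <= b`_i) ->
  g (pre ++ t) <= g (pre ++ b).
Proof.
elim: t b pre => [|x t IHt] [|y b] pre //= [tb] pn le_tb.
have le_xy := le_tb 0%N isT.
apply: (@le_trans _ _ (g (rcons pre y ++ t))).
  rewrite cat_rcons (@g_perm _ (x :: pre ++ t)); last 2 first.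
  - by rewrite size_cat /=.
  - by rewrite (perm_catCA pre [:: x] t).
  rewrite (@g_perm (pre ++ _) (y :: pre ++ t)); last 2 first.
  - by rewrite size_cat.
  - by rewrite (perm_catCA pre [:: y] t).
  by apply: g_mono => //; rewrite size_cat -addnS.
rewrite -cat_rcons; apply: IHt => //; first by rewrite size_rcons addSnnS.
by move=> i it; apply: (le_tb i.+1).
Qed.

(* The prefix [pre] collects the entries already made equal by T-transforms. *)
Lemma dominance_weak_majorization pre t b :
    size t = size b -> (size pre + size t = n)%N ->
    {in t, forall x, 0 <= x} -> {in b, forall x, 0 <= x} ->
    weakly_majorized t b ->
  g (pre ++ t) <= g (pre ++ b).
Proof.
have [k] := ubnP (size t); elim: k pre t b => // k IHk pre t b tk tb pn t0 b0 maj.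
have [t_nil|t_neq0] := eqVneq t [::].
  by move: tb; rewrite t_nil => /esym/size0nil->.
have [a at_ ta] := seq_max_exists t_neq0.
have [/allP all_b|] := boolP (all (>= a) b).
  apply: dominance_pointwise => // i it.
  by rewrite t0 ?mem_nth//= (le_trans (ta _ _) (all_b _ _)) ?mem_nth -?tb.
rewrite -has_predC has_filter => /seq_max_exists[q].
rewrite mem_filter /= -ltNge => /andP[qa qb] qP.
(* If every entry of [b] were below [a], then [q] would be its maximum, and at level [q] the excess
   of [b] would vanish while that of [t] would not. *)
have /seq_min_exists[p] : [seq x <- b | a <= x] != [::].
  rewrite -has_filter; apply/negPn/negP; rewrite -all_predC => /allP b_lt.
  have bq : {in b, forall x, x <= q}.
    by move=> x xb; apply: qP; rewrite mem_filter xb andbT; exact: b_lt.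
  have := maj q (b0 _ qb); rewrite (excess_eq0 bq) (excess_perm _ (perm_to_rem at_)).
  rewrite excess_cons => /le_gtF/negP; apply.
  by rewrite ltr_wpDr ?excess_ge0// lt_max subr_gt0 qa.
rewrite mem_filter => /andP[ap pb] pP.
have qbp : q \in rem p b.
  have := qb; rewrite (perm_mem (perm_to_rem pb)) inE => /predU1P[qp|//].
  by move: ap; rewrite -qp leNgt qa.
pose t' := rem a t; pose b' := rem q (rem p b).
have tE : perm_eq t (a :: t') by exact: perm_to_rem.
have bE : perm_eq b [:: p, q & b'].
  by rewrite (perm_trans (perm_to_rem pb))// perm_cons perm_to_rem.
have t't : {subset t' <= t} by move=> x; exact: mem_rem.
have b'b : {subset b' <= b} by move=> x /mem_rem/mem_rem.
have st : size t = (size t').+1 by rewrite (perm_size tE).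
have sb : size b = (size b').+2 by rewrite (perm_size bE).
have sb' : size t' = (size b').+1 by apply: succn_inj; rewrite -st -sb.
(* Replacing [p], [q] in [b] by [a], [p + q - a] does not increase [g]. Then [a] is common to both
   lists and joins the prefix, and the induction hypothesis treats the rest. *)
apply: (@le_trans _ _ (g (rcons pre a ++ (p + q - a) :: b'))).
  rewrite (@g_perm (pre ++ t) (rcons pre a ++ t')); last 2 first.
  - by rewrite size_cat.
  - by rewrite cat_rcons perm_cat2l.
  apply: IHk => //.
  - by rewrite -st.
  - by rewrite size_rcons addSnnS -st.
  - by move=> x /t't/t0.
  - move=> x; rewrite inE => /predU1P[->|/b'b/b0//].
    by have := b0 _ qb; lra.
  apply: (@weakly_majorized_transfer a p q) => //.
  - exact: b0.
  - by move=> x /t't/ta.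
  - move=> x /b'b xb; have [ax|xa] := leP a x.
      by right; apply: pP; rewrite mem_filter ax.
    by left; apply: qP; rewrite mem_filter /= -ltNge xa.
  move=> c c0; have := maj c c0.
  by rewrite (excess_perm _ tE) (excess_perm _ bE).
rewrite (@g_perm (rcons pre a ++ _) (a :: (p + q - a) :: pre ++ b')); last 2 first.
- by rewrite size_cat size_rcons /= addSnnS -sb' -st.
- by rewrite cat_rcons (perm_catCA pre [:: a; p + q - a] b').
rewrite (@g_perm (pre ++ b) [:: p, q & pre ++ b']); last 2 first.
- by rewrite size_cat -tb.
- by rewrite perm_sym (perm_catCA [:: p; q] pre b') perm_cat2l perm_sym.
apply: g_transfer; first by rewrite (ltW qa).
by rewrite size_cat -!addnS -sb' -st.
Qed.
End Dominance.
End WeakMajorization.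

(** * Spectral and singular value decompositions *)

Section ClosedField.
Variable C : numClosedFieldType.

Lemma mulmx_tC m n p (A : 'M[C]_(m, n)) (B : 'M[C]_(n, p)) :
  (A *m B)^t* = B^t* *m A^t*.
Proof. by rewrite trmx_mul map_mxM. Qed.

Lemma unitarymx_tCmul n (U : 'M[C]_n) : U \is unitarymx -> U^t* *m U = 1%:M.
Proof. by move/unitarymxP/mulmx1C. Qed.

Lemma hermitian_spectral n (A : 'M[C]_n) : A^t* = A ->
  A = (spectralmx A)^t* *m diag_mx (spectral_diag A) *m spectralmx A.
Proof.
move=> Ah; rewrite -invmx_unitary ?spectral_unitarymx//.
by apply: orthomx_spectralP; apply/normalmxP; rewrite Ah.
Qed.

(** If [V] diagonalises [H], the Gram matrix of [Z], then the columns of [W] are orthogonal with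
    squared norms the eigenvalues of [H]. Invertibility makes these positive, so the columns can be
    normalised to give a unitary factor. *)
Lemma svd_unitmx n (Z : 'M[C]_n) : Z \in unitmx ->
  exists (U V : 'M[C]_n) (t : 'rV[C]_n),
    [/\ U \is unitarymx, V \is unitarymx, forall i, 0 <= t 0 i
      & Z = U *m diag_mx t *m V].
Proof.
move=> Zu; pose H := Z^t* *m Z.
have Hh : H^t* = H by rewrite /H mulmx_tC trmxCK.
pose V := spectralmx H; pose d := spectral_diag H.
have Vu : V \is unitarymx by exact: spectral_unitarymx.
have HE : H = V^t* *m diag_mx d *m V by exact: hermitian_spectral.
pose W := Z *m V^t*.
have WW : W^t* *m W = diag_mx d.
  rewrite /W mulmx_tC trmxCK mulmxA -(mulmxA V) -/H HE !mulmxA.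
  by rewrite (unitarymxP Vu) mul1mx -mulmxA (unitarymxP Vu) mulmx1.
have Wu : W \in unitmx.
  by rewrite unitmx_mul Zu unitarymx_unit// trmxC_unitary.
have d_gt0 i : 0 < d 0 i.
  have dE : d 0 i = \sum_k `|W k i| ^+ 2.
    have /matrixP/(_ i i) := WW; rewrite !mxE eqxx mulr1n => <-.
    by apply: eq_bigr => k _; rewrite !mxE normCKC.
  rewrite lt_def {2}dE sumr_ge0 ?andbT => [|k _]; last exact: exprn_ge0.
  have : diag_mx d \in unitmx.
    by rewrite -WW unitmx_mul Wu map_unitmx unitmx_tr Wu.
  by rewrite unitmxE det_diag unitfE => /prodf_neq0; apply.
pose t : 'rV[C]_n := \row_i sqrtC (d 0 i).
pose s : 'rV[C]_n := \row_i (sqrtC (d 0 i))^-1.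
have st : diag_mx s *m diag_mx t = 1%:M.
  rewrite mulmx_diag; apply/matrixP => i j; rewrite !mxE mulVf//.
  by rewrite sqrtC_eq0 gt_eqF.
have sh : (diag_mx s)^t* = diag_mx s.
  rewrite tr_diag_mx map_diag_mx; congr diag_mx; apply/rowP => i; rewrite !mxE.
  by rewrite /= conj_Creal// ger0_real// invr_ge0 sqrtC_ge0 ltW.
have tt : diag_mx d = diag_mx t *m diag_mx t.
  rewrite mulmx_diag; congr diag_mx; apply/rowP => i.
  by rewrite !mxE -expr2 sqrtCK.
exists (W *m diag_mx s), V, t; split => //.
- apply/unitarymxP/mulmx1C; rewrite mulmx_tC sh mulmxA -(mulmxA (diag_mx s)) WW.
  by rewrite tt mulmxA st mul1mx; apply: mulmx1C.
- by move=> i; rewrite mxE sqrtC_ge0 ltW.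
- by rewrite -(mulmxA W) st mulmx1 /W -mulmxA unitarymx_tCmul// mulmx1.
Qed.

(** The sum is singular only if [d] is an eigenvalue of [- Q]. The [size p] distinct candidates
    [e / (k + 1)] exceed the degree of the characteristic polynomial, so one of them is not a
    root. *)
Lemma unitmx_addscalar n (Q : 'M[C]_n) (e : C) : 0 < e ->
  exists2 d : C, 0 < d <= e & Q + d%:M \in unitmx.
Proof.
move=> e0; pose p := char_poly (- Q).
have p0 : p != 0 by rewrite monic_neq0 ?char_poly_monic.
pose rs := [seq e / k.+1%:R | k <- iota 0 (size p)].
have /allPn[_ /mapP[k _ ->]] : ~~ all (root p) rs.
  apply/negP => /(max_poly_roots p0); rewrite map_inj_uniq ?iota_uniq.
    by rewrite size_map size_iota ltnn => /(_ isT).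
  move=> i j /(mulfI (lt0r_neq0 e0))/invr_inj/eqP.
  by rewrite eqr_nat => /eqP[].
rewrite -eigenvalue_root_char => kP; exists (e / k.+1%:R).
  by rewrite divr_gt0 ?ltr0n//= ler_pdivrMr ?ltr0n// ler_peMr ?ler1n// ltW.
move: kP; rewrite /eigenvalue negbK kermx_eq0 row_free_unit -opprD.
by rewrite -scaleN1r unitmxZ ?unitrN1.
Qed.
End ClosedField.

(** * Sesquilinear forms and Hadamard products *)

Section Forms.
Variables (C : numClosedFieldType) (n : nat).
Implicit Types (A B P Q U V X Y : 'M[C]_n) (u v w x : 'cV[C]_n) (d : 'rV[C]_n).

Definition form A v u : C := (u^t* *m A *m v) 0 0.

Definition psd A : Prop := A^t* = A /\ forall v, 0 <= form A v v.

Lemma formE A v u :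
  form A v u = \sum_i \sum_j Num.conj (u i 0) * A i j * v j 0.
Proof.
rewrite /form mxE exchange_big /=; apply: eq_bigr => j _.
by rewrite !mxE big_distrl /=; apply: eq_bigr => i _; rewrite !mxE.
Qed.

Lemma formDm A B v u : form (A + B) v u = form A v u + form B v u.
Proof. by rewrite /form mulmxDr mulmxDl mxE. Qed.

Lemma formZm c A v u : form (c *: A) v u = c * form A v u.
Proof. by rewrite /form -scalemxAr -scalemxAl mxE. Qed.

Lemma formNm A v u : form (- A) v u = - form A v u.
Proof. by rewrite /form mulmxN mulNmx mxE. Qed.

Lemma formDl A v w u : form A (v + w) u = form A v u + form A w u.
Proof. by rewrite /form mulmxDr mxE. Qed.

Lemma formZl c A v u : form A (c *: v) u = c * form A v u.
Proof. by rewrite /form -scalemxAr mxE. Qed.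

Lemma form_tC A v u : form (A^t* ) v u = Num.conj (form A u v).
Proof.
rewrite !formE rmorph_sum exchange_big; apply: eq_bigr => j _.
rewrite rmorph_sum; apply: eq_bigr => i _.
by rewrite !mxE !rmorphM /= conjCK [LHS]mulrC [LHS]mulrA [LHS]mulrAC.
Qed.

Lemma form_herm A v u : A^t* = A -> form A v u = Num.conj (form A u v).
Proof. by move=> Ah; rewrite -form_tC Ah. Qed.

Lemma formDr A v u w : form A v (u + w) = form A v u + form A v w.
Proof. by rewrite -[A]trmxCK !(form_tC (A^t* )) formDl rmorphD. Qed.

Lemma formZr c A v u : form A v (c *: u) = Num.conj c * form A v u.
Proof. by rewrite -[A]trmxCK !(form_tC (A^t* )) formZl rmorphM. Qed.

Lemma form_mx U A V i j : (U *m A *m V) i j = form A (col j V) (col i (U^t* )).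
Proof.
rewrite formE mxE exchange_big /=; apply: eq_bigr => k _.
rewrite !mxE big_distrl /=; apply: eq_bigr => l _.
by rewrite !mxE conjCK.
Qed.

Lemma form1E v : form 1%:M v v = \sum_i `|v i 0| ^+ 2.
Proof.
rewrite /form mulmx1 mxE; apply: eq_bigr => i _.
by rewrite !mxE normCKC.
Qed.

Lemma form1_ge0 v : 0 <= form 1%:M v v.
Proof. by rewrite form1E sumr_ge0 // => i _; rewrite exprn_ge0. Qed.

Lemma form1_eq0 v : form 1%:M v v = 0 -> v = 0.
Proof.
rewrite form1E => /eqP; rewrite psumr_eq0 => [/allP v0|i _]; last exact: exprn_ge0.
apply/colP => i; rewrite mxE; apply/eqP.
by have := v0 i (mem_index_enum i); rewrite /= sqrf_eq0 normr_eq0.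
Qed.

Lemma form1_col U i : U \is unitarymx -> form 1%:M (col i U) (col i U) = 1.
Proof.
move=> Uu; have := form_mx (U^t* ) 1%:M U i i.
by rewrite trmxCK mulmx1 unitarymx_tCmul// mxE eqxx.
Qed.

(** Cauchy-Schwarz with the arithmetic mean on the right: positivity at [u - w v], where [w] is the
    unimodular number with [w z = |z|]. The case [z = 0], where this phase is undefined, is
    separate. *)
Lemma psd_le_mean P v u : psd P ->
  `|form P v u| <= 2^-1 * (form P u u + form P v v).
Proof.
move=> [Ph P0]; set z := form P v u.
have [->|z0] := eqVneq z 0.
  by rewrite normr0 mulr_ge0 ?invr_ge0 ?ler0n ?addr_ge0.
pose w := Num.conj z / `|z|.
have nz0 : `|z| != 0 by rewrite normr_eq0.
have wz : w * z = `|z| by rewrite /w mulrAC -normCKC expr2 mulfK.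
have ww : Num.conj w * w = 1.
  by rewrite -normCKC /w normrM normfV normr_id norm_conjC divff// expr1n.
have : 0 <= form P (u + - w *: v) (u + - w *: v) by exact: P0.
rewrite formDl !formDr !formZl !formZr (form_herm u v Ph) -/z.
rewrite rmorphN.
have -> : form P u u + - Num.conj w * Num.conj z +
    (- w * z + - w * (- Num.conj w * form P v v)) =
    form P u u + Num.conj w * w * form P v v - w * z - Num.conj w * Num.conj z.
  by ring.
rewrite -rmorphM /= ww wz conj_normC mul1r -addrA -opprD subr_ge0 => h.
by rewrite mulrC ler_pdivlMr ?ltr0n// mulr_natr mulr2n.
Qed.

Lemma spectral_form A U d k : U \is unitarymx -> A = U^t* *m diag_mx d *m U ->
  d 0 k = form A (col k (U^t* )) (col k (U^t* )).
Proof.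
move=> Uu ->; rewrite -form_mx !mulmxA (unitarymxP Uu) mul1mx -mulmxA.
by rewrite (unitarymxP Uu) mulmx1 mxE eqxx.
Qed.

(** The vector on which [A] is evaluated when its Hadamard product with the rank-one matrix built
    from row [k] of [U] is evaluated on [v]. *)
Definition row_scale U k v : 'cV[C]_n := \col_i (U k i * v i 0).

End Forms.

Section Hadamard.
Variables (R : realType) (n : nat).
Local Notation C := R[i].
Implicit Types (A B P Q U V X Y : 'M[C]_n) (u v w x : 'cV[C]_n) (d : 'rV[C]_n).

Lemma hadamardC X Y : hadamard X Y = hadamard Y X.
Proof. by apply/matrixP => i j; rewrite !mxE mulrC. Qed.

Lemma hadamardDl X Y P : hadamard (X + Y) P = hadamard X P + hadamard Y P.
Proof. by apply/matrixP => i j; rewrite !mxE mulrDl. Qed.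

Lemma hadamardZl c X Y : hadamard (c *: X) Y = c *: hadamard X Y.
Proof. by apply/matrixP => i j; rewrite !mxE mulrA. Qed.

Lemma hadamardDr X Y P : hadamard P (X + Y) = hadamard P X + hadamard P Y.
Proof. by rewrite hadamardC hadamardDl !(hadamardC P). Qed.

Lemma hadamardZr c X Y : hadamard X (c *: Y) = c *: hadamard X Y.
Proof. by rewrite hadamardC hadamardZl (hadamardC X). Qed.

(** The second factor is a sum of rank-one matrices, one for each row of [U], and the Hadamard
    product with each is a diagonal congruence of [A]. *)
Lemma form_hadamard_spectral A U d v :
  form (hadamard A (U^t* *m diag_mx d *m U)) v v =
  \sum_k d 0 k * form A (row_scale U k v) (row_scale U k v).
Proof.
under eq_bigr do rewrite formE big_distrr /=.
rewrite [LHS]formE [RHS]exchange_big /=; apply: eq_bigr => i _.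
under [RHS]eq_bigr do rewrite big_distrr /=.
rewrite [RHS]exchange_big /=; apply: eq_bigr => j _.
rewrite !mxE big_distrr /= big_distrr big_distrl /=; apply: eq_bigr => k _.
rewrite mul_mx_diag !mxE rmorphM /=; ring.
Qed.

(** The Schur product theorem: after diagonalising [B], the form is a combination of values of the
    form of [A] with the eigenvalues of [B] as coefficients. *)
Lemma hadamard_psd A B : psd A -> psd B -> psd (hadamard A B).
Proof.
move=> [Ah A0] [Bh B0]; split=> [|v].
  apply/matrixP => i j; rewrite !mxE rmorphM.
  by rewrite -{2}Ah -{2}Bh !mxE.
have BE := hermitian_spectral Bh; rewrite BE form_hadamard_spectral.
apply: sumr_ge0 => k _; rewrite mulr_ge0//.
by rewrite (spectral_form _ _ BE) ?spectral_unitarymx.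
Qed.

(** With all eigenvalues 1 the second factor is the identity, so the sum is the mean of the diagonal
    entries of [A] with weights [|v_i|^2]. *)
Lemma sum_row_scale_le A U v (a : C) : U \is unitarymx -> form 1%:M v v = 1 ->
    (forall i, A i i <= a) ->
  \sum_k form A (row_scale U k v) (row_scale U k v) <= a.
Proof.
move=> Uu v1 Aa.
have -> : \sum_k form A (row_scale U k v) (row_scale U k v) =
    form (hadamard A 1%:M) v v.
  have := form_hadamard_spectral A U (const_mx 1) v.
  rewrite diag_const_mx mulmx1 unitarymx_tCmul// => ->.
  by apply: eq_bigr => k _; rewrite mxE mul1r.
have -> : form (hadamard A 1%:M) v v = \sum_i A i i * `|v i 0| ^+ 2.
  rewrite formE; apply: eq_bigr => i _.
  rewrite (bigD1 i)//= big1 ?addr0 => [|j ji]; rewrite !mxE.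
    by rewrite eqxx mulr1 normCKC mulrAC mulrC mulrA.
  by rewrite eq_sym (negPf ji) mulr0 mulr0 mul0r.
rewrite -[a]mulr1 -v1 form1E mulr_sumr; apply: ler_sum => i _.
by rewrite ler_wpM2r ?exprn_ge0.
Qed.
End Hadamard.

(** * Sectorial matrices *)

Section Sectorial.
Variables (R : realType) (n : nat).
Local Notation C := R[i].
Implicit Types (A B P Q U V X Y : 'M[C]_n) (u v w x : 'cV[C]_n) (d : 'rV[C]_n).

Lemma tCD A B : (A + B)^t* = A^t* + B^t*.
Proof. by rewrite linearD map_mxD. Qed.

Lemma tCN A : (- A)^t* = - A^t*.
Proof. by rewrite linearN map_mxN. Qed.

Lemma tCZ (c : C) A : (c *: A)^t* = Num.conj c *: A^t*.
Proof. by rewrite linearZ map_mxZ. Qed.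

Lemma tCZr (c : R) A : (c%:C *: A)^t* = c%:C *: A^t*.
Proof. by rewrite tCZ conj_Creal// complex_real. Qed.

Lemma inner_form X v : inner (X *m v) v = form X v v.
Proof.
rewrite /inner dotmxE /form -mulmxA [LHS]mxE [RHS]mxE; apply: eq_bigr => j _.
by rewrite mulrC; congr (_ * _); rewrite !mxE.
Qed.

Definition immx X : 'M[C]_n := (- 'i / 2) *: (X - X^t* ).

Lemma remx_herm X : (remx X)^t* = remx X.
Proof.
rewrite /remx tCZ tCD trmxCK addrC; congr (_ *: _).
by rewrite conj_Creal// realV realn.
Qed.

Lemma immx_herm X : (immx X)^t* = immx X.
Proof.
rewrite /immx tCZ tCD tCN trmxCK -opprB scalerN.
rewrite -scaleNr; congr (_ *: _); apply/eqP; rewrite eq_complex /=.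
by apply/andP; split; apply/eqP; field.
Qed.

Lemma remx_immx X : X = remx X + 'i *: immx X.
Proof.
rewrite /remx /immx; apply/matrixP => i j; rewrite !mxE.
have := sqr_i R; set I := 'i; set x := X i j; set y := Num.conj _ => I2.
have -> : I * (- I / 2 * (x - y)) = - I ^+ 2 / 2 * (x - y) by ring.
by rewrite I2; field.
Qed.

Lemma form_remx X v : form (remx X) v v = (complex.Re (form X v v))%:C.
Proof.
rewrite /remx formZm formDm form_tC; set q := form X v v.
by rewrite [q + _]addcJ mulKf// pnatr_eq0.
Qed.

Lemma form_immx X v : form (immx X) v v = (complex.Im (form X v v))%:C.
Proof.
rewrite /immx formZm formDm formNm form_tC; set q := form X v v.
rewrite [q - _]subcJ; have := sqr_i R; set I := 'i => I2.
have -> : - I / 2 * (2 * (complex.Im q)%:C * I) = - I ^+ 2 * (complex.Im q)%:C by field.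
by rewrite I2 opprK mul1r.
Qed.

Lemma herm_form_eq0 A : A^t* = A -> (forall v, form A v v = 0) -> A = 0.
Proof.
move=> Ah A0; have AE := hermitian_spectral Ah; rewrite AE.
suff -> : diag_mx (spectral_diag A) = 0 by rewrite mulmx0 mul0mx.
apply/matrixP => i j; rewrite !mxE (spectral_form _ _ AE) ?spectral_unitarymx//.
by rewrite A0 mul0rn.
Qed.

(** The sector is a cone, so the unit-vector condition extends by scaling; [v] is nonzero because
    the sector omits the origin. *)
Lemma numrange_sector_form (a : R) X v : numrange X `<=` sector a -> v != 0 ->
  sector a (form X v v).
Proof.
move=> Xa v0; pose q := form 1%:M v v.
have q0 : 0 < q.
  rewrite lt_def form1_ge0 andbT; apply: contra_neq v0; exact: form1_eq0.
pose c := (sqrtC q)^-1.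
have c0 : 0 < c by rewrite invr_gt0 sqrtC_gt0.
have cc : Num.conj c * c = q^-1.
  by rewrite conj_Creal ?gtr0_real// -expr2 exprVn sqrtCK.
have form_cv A : form A (c *: v) (c *: v) = q^-1 * form A v v.
  by rewrite formZl formZr mulrCA mulrA cc.
have Xq : sector a (q^-1 * form X v v).
  apply: Xa; exists (c *: v); last by rewrite inner_form form_cv.
  have := inner_form 1%:M (c *: v); rewrite mul1mx /= /enorm => ->.
  by rewrite form_cv mulVf ?sqrtC1// gt_eqF.
have [r qr] : exists r, q = r%:C by apply/complex_realP; rewrite gtr0_real.
have r0 : 0 < r by move: q0; rewrite qr ltcE /= => /andP[].
have -> : form X v v = r%:C * (q^-1 * form X v v).
  by rewrite -qr mulVKf// gt_eqF.
move: Xq; case: (q^-1 * _) => x y; rewrite /sector /= => -[x0 yx].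
rewrite !mul0r subr0 addr0 normrM (gtr0_norm r0) mulr_gt0//; split=> //.
by rewrite mulrCA ler_pM2l.
Qed.

Lemma form0 X : form X 0 0 = 0.
Proof. by rewrite formE big1 // => i _; rewrite big1 // => j _; rewrite !mxE mulr0. Qed.

Lemma numrange_sector_psd (a : R) X : numrange X `<=` sector a -> psd (remx X).
Proof.
move=> Xa; split=> [|v]; first exact: remx_herm.
rewrite form_remx ler0c; have [->|v0] := eqVneq v 0.
  by rewrite form0.
by have [/ltW] := numrange_sector_form Xa v0.
Qed.

(* In the Hermitian/skew splitting [X = A + i B] the two summands are
   [P = (A / cos a +- B / sin a) / 2], with phases [exp (+- i a)]: positivity of
   both is exactly the sector condition. At [a = 0] the junk value
   [(sin a)^-1 = 0] is harmless since then [B = 0]. *)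
Lemma sector_decomposition (a : R) X : 0 <= a < pi / 2 ->
    numrange X `<=` sector a ->
  exists (P1 P2 : 'M[C]_n) (z1 z2 : C),
    [/\ psd P1 /\ psd P2, `|z1| = 1, `|z2| = 1, X = z1 *: P1 + z2 *: P2
      & P1 + P2 = (sec a)%:C *: remx X].
Proof.
move=> /andP[a0 api] Xa; set A := remx X; pose B := immx X.
have Ah : A^t* = A by exact: remx_herm.
have Bh : B^t* = B by exact: immx_herm.
have formA v : form A v v = (complex.Re (form X v v))%:C by exact: form_remx.
have formB v : form B v v = (complex.Im (form X v v))%:C by exact: form_immx.
have XE : X = A + 'i *: B by exact: remx_immx.
clearbody A B.
pose c := cos a; pose s := sin a.
have c0 : 0 < c.
  by rewrite /c cos_gt0_pihalf// api andbT (lt_le_trans _ a0)// oppr_lt0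
    divr_gt0 ?pi_gt0.
have s0 : 0 <= s.
  by rewrite /s sin_ge0_pi// a0 /=; have := pi_gt0 R; lra.
have Xsec v : 0 <= complex.Re (form X v v) /\
    `|complex.Im (form X v v)| <= s / c * complex.Re (form X v v).
  have [->|v0] := eqVneq v 0; first by rewrite form0 /= normr0 mulr0.
  by have [/ltW] := numrange_sector_form Xa v0.
have ssB : (s * s^-1)%:C *: B = B.
  have [s00|sn0] := eqVneq s 0; last by rewrite divff// scale1r.
  suff -> : B = 0 by rewrite scaler0.
  apply: herm_form_eq0 => // v.
  have [_] := Xsec v; rewrite s00 !mul0r normr_le0 formB => /eqP->.
  by [].
have sd v : s^-1 * `|complex.Im (form X v v)| <= c^-1 * complex.Re (form X v v).
  have [Re0 Im0] := Xsec v.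
  have [s00|sn0] := eqVneq s 0.
    by rewrite s00 invr0 mul0r mulr_ge0// invr_ge0 ltW.
  rewrite mulrC ler_pdivrMr ?lt_def ?sn0//; apply: le_trans Im0 _.
  by rewrite mulrAC [s * _]mulrC mulrAC [_ * c^-1]mulrC.
pose P (e : R) := (2^-1 * c^-1)%:C *: A + (e * 2^-1 * s^-1)%:C *: B.
have P_psd e : `|e| = 1 -> psd (P e).
  move=> e1; split=> [|v]; first by rewrite /P tCD !tCZr Ah Bh.
  rewrite /P formDm !formZm formA formB -!rmorphM -rmorphD ler0c.
  have := sd v; set q := form X v v => sdq.
  have : - (s^-1 * `|complex.Im q|) <= e * (s^-1 * complex.Im q).
    rewrite lerNl; apply: le_trans (ler_norm _) _.
    rewrite normrN !normrM e1 mul1r (ger0_norm (_ : 0 <= s^-1)) ?invr_ge0//.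
  by lra.
exists (P 1), (P (-1)), (c +i* s), (c +i* - s); split.
- by split; apply: P_psd; rewrite ?normrN normr1.
- by rewrite normc_def /= cos2Dsin2 sqrtr1.
- by rewrite normc_def /= sqrrN cos2Dsin2 sqrtr1.
- rewrite XE -{1}ssB -{1}(scale1r A).
  have cn0 : c != 0 by rewrite gt_eqF.
  rewrite /P !scalerDr addrACA !scalerA -!scalerDl; congr (_ *: _ + _ *: _).
    by apply/eqP; rewrite eq_complex /=; apply/andP; split; apply/eqP; field.
  apply/eqP; rewrite eq_complex /=.
  by apply/andP; split; apply/eqP; set t := s^-1; field.
- rewrite /P addrACA -!scalerDl -!rmorphD /=.
  have -> : 1 * 2^-1 * s^-1 + -1 * 2^-1 * s^-1 = 0 by ring.
  rewrite scale0r addr0; congr (_%:C *: _); rewrite /sec -/c; field.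
  by rewrite gt_eqF.
Qed.
End Sectorial.

(** * Unitarily invariant norms *)

Section UnitarilyInvariantNorm.
Variables (R : realType) (n : nat) (N : 'M[R[i]]_n -> R).
Hypotheses (hN : is_norm N) (hui : norm_unitarily_invariant N).
Local Notation C := R[i].
Implicit Types (A B P Q U V X Y : 'M[C]_n) (s : seq R) (t b : 'I_n -> R).

Definition diagr t : 'M[C]_n := diag_mx (\row_i (t i)%:C).

Lemma modulus_real (c : R) : modulus c%:C = `|c|.
Proof. by rewrite /modulus /= expr0n addr0 sqrtr_sqr. Qed.

Lemma norm_real_scale (c : R) X : 0 <= c -> N (c%:C *: X) = c * N X.
Proof. by move=> c0; rewrite (norm_scale hN) modulus_real ger0_norm. Qed.

Lemma unitarymx1 : (1%:M : 'M[C]_n) \is unitarymx.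
Proof. by apply/unitarymxP; rewrite mul1mx trmx1 map_mx1. Qed.

Lemma norm_convex_le (l : R) X Y : 0 <= l <= 1 -> N X = N Y ->
  N (l%:C *: X + (1 - l)%:C *: Y) <= N Y.
Proof.
move=> /andP[l0 l1] XY; apply: le_trans (norm_triangle hN _ _) _.
rewrite !norm_real_scale ?subr_ge0// XY -mulrDl; lra.
Qed.

Lemma diagr_convex (l : R) t t1 t2 : 0 <= l <= 1 -> N (diagr t1) = N (diagr t2) ->
  (forall i, t i = l * t1 i + (1 - l) * t2 i) -> N (diagr t) <= N (diagr t2).
Proof.
move=> l01 E tE; rewrite (_ : diagr t = l%:C *: diagr t1 + (1 - l)%:C *: diagr t2).
  exact: norm_convex_le.
apply/matrixP => i j; rewrite !mxE tE.
by case: (i == j); rewrite ?mulr0n ?mulr0 ?addr0// !mulr1n rmorphD !rmorphM.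
Qed.

Lemma diagr_perm t (p : {perm 'I_n}) : N (diagr (fun i => t (p i))) = N (diagr t).
Proof.
have pu : (perm_mx p : 'M[C]_n) \is unitarymx.
  by apply/unitarymxP; rewrite tr_perm_mx map_perm_mx -perm_mxM mulgV perm_mx1.
rewrite -[RHS](hui _ pu (V := (perm_mx p)^t* )) ?trmxC_unitary//; congr N.
apply/matrixP => i j; rewrite -row_permE tr_perm_mx map_perm_mx -col_permE !mxE.
by rewrite (inj_eq perm_inj).
Qed.

Lemma diagr_sign t (e : 'I_n -> bool) :
  N (diagr (fun i => (-1) ^+ e i * t i)) = N (diagr t).
Proof.
pose D : 'M[C]_n := diagr (fun i => (-1) ^+ e i).
have Du : D \is unitarymx.
  apply/unitarymxP; rewrite tr_diag_mx map_diag_mx mulmx_diag.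
  rewrite -diag_const_mx; congr diag_mx; apply/rowP => i; rewrite !mxE.
  transitivity (((-1) ^+ e i)%:C * ((-1) ^+ e i)%:C : C).
    by congr (_ * _); apply: conj_Creal; rewrite complex_real.
  by rewrite -rmorphM -expr2 sqrr_sign.
rewrite -[RHS](hui _ Du unitarymx1) mulmx1 mulmx_diag; congr N.
by congr diag_mx; apply/rowP => i; rewrite !mxE rmorphM.
Qed.

(** The symmetric gauge function of [N], on lists since the dominance argument removes and permutes
    entries. On lists of length [n] the default of [nth] is never reached. *)
Definition gauge s : R := N (diagr (fun i => s`_i)).

Lemma gauge_perm s s' : size s = n -> perm_eq s s' -> gauge s = gauge s'.
Proof.
move=> sn ss'; have s'n : size s' = n by rewrite -(perm_size ss').
pose u := Tuple (introT eqP s'n); pose u' := Tuple (introT eqP sn).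
have /tuple_permP[p pE] : perm_eq u' u by [].
rewrite /gauge -(diagr_perm (fun i => s'`_i) p); congr N; congr diag_mx.
apply/rowP => i; rewrite !mxE; congr _%:C.
have -> : s = [tuple tnth u (p i) | i < n] by rewrite -pE.
by rewrite -tnth_nth tnth_mktuple (tnth_nth 0).
Qed.

(** The entry [x] is a convex combination of [- y] and [y], and flipping the sign of one diagonal
    entry preserves the norm. *)
Lemma gauge_mono (x y : R) s : 0 <= x <= y -> (size s).+1 = n ->
  gauge (x :: s) <= gauge (y :: s).
Proof.
move=> /andP[x0 xy] _; have [y0|yn0] := eqVneq y 0.
  suff -> : x = y by [].
  by apply/le_anti; rewrite xy y0 x0.
have y0 : 0 < y by lra.
apply: (@diagr_convex (2^-1 - x / y / 2) _
   (fun i => (-1) ^+ (i == 0%N :> nat) * (y :: s)`_i)) => [||i].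
- have : 0 <= x / y <= 1.
    by apply/andP; split; [rewrite divr_ge0// ltW | rewrite ler_pdivrMr// mul1r].
  by lra.
- exact: diagr_sign.
- case: (nat_of_ord i) => [|k] /=; first by rewrite expr1; field.
  by rewrite expr0; ring.
Qed.

(** The T-transform is a convex combination of the list and of its copy with [p] and [q] swapped,
    which have the same norm. *)
Lemma gauge_transfer (p q x : R) s : q <= x <= p -> (size s).+2 = n ->
  gauge (x :: p + q - x :: s) <= gauge (p :: q :: s).
Proof.
move=> /andP[qx xp] sn; have [pq|pq] := eqVneq p q.
  suff -> : x = p by rewrite addrC addKr.
  by apply/le_anti; rewrite xp pq qx.
have pq0 : 0 < p - q by rewrite subr_gt0 lt_def pq (le_trans qx).
apply: (@diagr_convex ((p - x) / (p - q)) _ (fun i => [:: q, p & s]`_i)) => [||i].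
- apply/andP; split; first by rewrite divr_ge0 ?subr_ge0// ltW// -subr_gt0.
  by rewrite ler_pdivrMr// mul1r lerD2l lerN2.
- by apply: gauge_perm => //=; rewrite (perm_catCA [:: q] [:: p] s).
- case: (nat_of_ord i) => [|[|k]] /=.
  + by field; rewrite gt_eqF.
  + by field; rewrite gt_eqF.
  + by ring.
Qed.

Lemma diagr_gauge t : N (diagr t) = gauge [tuple t i | i < n].
Proof.
congr N; congr diag_mx; apply/rowP => i.
by rewrite !mxE -tnth_nth tnth_mktuple.
Qed.

Lemma excess_mktuple (c : R) t :
  excess c [tuple t i | i < n] = \sum_i Num.max (t i - c) 0.
Proof. by rewrite /excess big_tuple; apply: eq_bigr => i _; rewrite tnth_mktuple. Qed.

(** The hypotheses give weak majorization of [t] by [b]: for [c >= 0] the row sums let [c] be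
    subtracted inside the combination, and the column sums bound the total after exchanging the
    sums. *)
Lemma diagr_le_substochastic (M : 'I_n -> 'I_n -> R) t b :
    (forall i, 0 <= t i) -> (forall j, 0 <= b j) -> (forall i j, 0 <= M i j) ->
    (forall i, \sum_j M i j <= 1) -> (forall j, \sum_i M i j <= 1) ->
    (forall i, t i <= \sum_j M i j * b j) ->
  N (diagr t) <= N (diagr b).
Proof.
move=> t0 b0 M0 rowM colM tM; rewrite !diagr_gauge.
apply: (@dominance_weak_majorization _ n gauge gauge_perm gauge_mono gauge_transfer
  [::]).
- by rewrite !size_tuple.
- by rewrite add0n size_tuple.
- by move=> _ /tnthP[i ->]; rewrite tnth_mktuple.
- by move=> _ /tnthP[i ->]; rewrite tnth_mktuple.
move=> c c0; rewrite !excess_mktuple.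
apply: (@le_trans _ _ (\sum_i \sum_j M i j * Num.max (b j - c) 0)).
  apply: ler_sum => i _; rewrite ge_max sumr_ge0 ?andbT => [|j _]; last first.
    by rewrite mulr_ge0// le_max lexx orbT.
  apply: (@le_trans _ _ (\sum_j M i j * (b j - c))).
    under eq_bigr do rewrite mulrBr.
    by rewrite sumrB -mulr_suml lerB// ler_piMl.
  by apply: ler_sum => j _; rewrite ler_wpM2l// le_max lexx.
rewrite exchange_big /=; apply: ler_sum => j _.
by rewrite -mulr_suml ler_piMl// le_max lexx orbT.
Qed.

Lemma diagr_mono t b : (forall i, 0 <= t i <= b i) -> N (diagr t) <= N (diagr b).
Proof.
move=> tb; have sumd (F : 'I_n -> R) i : \sum_j (i == j)%:R * F j = F i.
  rewrite (bigD1 i)//= eqxx mul1r big1 ?addr0// => j.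
  by rewrite eq_sym => /negPf->; rewrite mul0r.
apply: (@diagr_le_substochastic (fun i j => (i == j)%:R)) => //.
- by move=> i; have /andP[] := tb i.
- by move=> i; have /andP[/le_trans h /h] := tb i.
- by move=> i; have := sumd (fun=> 1) i; under eq_bigr do rewrite mulr1; move->.
- move=> j; have := sumd (fun=> 1) j.
  by under eq_bigr do rewrite mulr1 eq_sym; move->.
- by move=> i; rewrite sumd; have /andP[] := tb i.
Qed.
End UnitarilyInvariantNorm.

(** * From bounds on forms to bounds on norms *)

Lemma half_sum4 (F : numFieldType) (x1 x2 x3 x4 y1 y2 y3 y4 : F) :
  2^-1 * (x1 + y1) + 2^-1 * (x2 + y2) + (2^-1 * (x3 + y3) + 2^-1 * (x4 + y4)) =
  2^-1 * (x1 + x2 + (x3 + x4) + (y1 + y2 + (y3 + y4))).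
Proof. by ring. Qed.

Section NormBound.
Variables (R : realType) (n : nat) (N : 'M[R[i]]_n -> R).
Hypotheses (hN : is_norm N) (hui : norm_unitarily_invariant N).
Local Notation C := R[i].
Implicit Types (A B P Q U V X Y : 'M[C]_n) (u v : 'cV[C]_n).

Lemma psd_form_real P v : psd P -> (complex.Re (form P v v))%:C = form P v v.
Proof. by move=> [_ P0]; rewrite RRe_real// ger0_real. Qed.

Lemma psd1 : psd (1%:M : 'M[C]_n).
Proof. by split=> [|v]; [rewrite trmx1 map_mx1 | exact: form1_ge0]. Qed.

(** The product expands into four unimodular multiples of positive semidefinite matrices. The phases
    vanish in modulus, and the four mean bounds add up to the form of the product of the sums. *)
Lemma hadamard_form_le P1 P2 Q1 Q2 (z1 z2 w1 w2 : C) u v :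
    psd P1 -> psd P2 -> psd Q1 -> psd Q2 ->
    `|z1| = 1 -> `|z2| = 1 -> `|w1| = 1 -> `|w2| = 1 ->
  `|form (hadamard (z1 *: P1 + z2 *: P2) (w1 *: Q1 + w2 *: Q2)) v u| <=
  2^-1 * (form (hadamard (P1 + P2) (Q1 + Q2)) u u
          + form (hadamard (P1 + P2) (Q1 + Q2)) v v).
Proof.
move=> p1 p2 q1 q2 z11 z21 w11 w21.
have term P Q (z w : C) : psd P -> psd Q -> `|z| = 1 -> `|w| = 1 ->
    `|form (hadamard (z *: P) (w *: Q)) v u| <=
    2^-1 * (form (hadamard P Q) u u + form (hadamard P Q) v v).
  move=> pP pQ z1' w1'; rewrite hadamardZl hadamardZr !formZm !normrM z1' w1' !mul1r.
  exact/psd_le_mean/hadamard_psd.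
rewrite !hadamardDl !hadamardDr !formDm.
apply: le_trans (ler_normD _ _) _.
apply: le_trans (lerD (ler_normD _ _) (ler_normD _ _)) _.
apply: le_trans (lerD (lerD (term _ _ _ _ p1 q1 z11 w11) (term _ _ _ _ p1 q2 z11 w21))
  (lerD (term _ _ _ _ p2 q1 z21 w11) (term _ _ _ _ p2 q2 z21 w21))) _.
by rewrite half_sum4.
Qed.

Lemma hadamard_form_le_scaled P1 P2 Q1 Q2 A B (z1 z2 w1 w2 c d : C) u v :
    psd P1 -> psd P2 -> psd Q1 -> psd Q2 ->
    `|z1| = 1 -> `|z2| = 1 -> `|w1| = 1 -> `|w2| = 1 ->
    P1 + P2 = c *: A -> Q1 + Q2 = d *: B ->
  `|form (hadamard (z1 *: P1 + z2 *: P2) (w1 *: Q1 + w2 *: Q2)) v u| <=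
  c * d * (2^-1 * (form (hadamard A B) u u + form (hadamard A B) v v)).
Proof.
move=> pP1 pP2 pQ1 pQ2 z11 z21 w11 w21 PE QE.
apply: le_trans (hadamard_form_le u v pP1 pP2 pQ1 pQ2 z11 z21 w11 w21) _.
rewrite PE QE hadamardZl hadamardZr scalerA !(formZm (c * d)) -mulrDr.
by rewrite [leRHS]mulrCA.
Qed.

(* Perturbing [Q] to an invertible [Q + d] gives access to singular values
   [t i = <(Q + d) v_i, u_i>]. Diagonalising [B] with eigenvalues [b j] bounds
   them by [K a \sum_j M i j b_j + d] with [M] doubly substochastic. *)
Lemma norm_le_of_form (K a : R) A B Q : 0 < K -> 0 < a -> psd A -> psd B ->
    (forall i, A i i <= a%:C) ->
    (forall u v, `|form Q v u| <=
       K%:C * (2^-1 * (form (hadamard A B) u u + form (hadamard A B) v v))) ->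
  N Q <= K * a * N B.
Proof.
move=> K0 a0 Ap Bp Aa QK; apply/ler_addgt0Pr => e e0.
have N1 : 0 <= N 1%:M by exact: norm_ge0.
(* The perturbation [d] costs [d * N 1%:M] twice, in bounding the singular values and in returning
   from [Q + d] to [Q]; the added 1 keeps the denominator positive. *)
have e'0 : 0 < e / (2 * (N 1%:M + 1)) by rewrite divr_gt0 ?mulr_gt0// ltr_wpDl.
have [dC /andP[dC0 dCe] Qd] : exists2 d : C, 0 < d <= (e / (2 * (N 1%:M + 1)))%:C
    & Q + d%:M \in unitmx by apply: unitmx_addscalar; rewrite ltcR.
have [d dE] : exists d, dC = d%:C by apply/complex_realP; rewrite gtr0_real.
move: dC0 dCe Qd; rewrite {}dE ltcR lecR => d0 de Qd.
have [U [V [t [Uu Vu t0 QE]]]] := svd_unitmx Qd.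
have [Bh B0] := Bp; have BE := hermitian_spectral Bh.
set W := spectralmx B in BE; set b := spectral_diag B in BE.
have Wu : W \is unitarymx by exact: spectral_unitarymx.
have b0 j : 0 <= b 0 j by rewrite (spectral_form _ Wu BE).
pose T i := complex.Re (t 0 i); pose be j := complex.Re (b 0 j).
have TE i : (T i)%:C = t 0 i by rewrite /T RRe_real// ger0_real.
have beE j : (be j)%:C = b 0 j by rewrite /be RRe_real// ger0_real.
have T0 i : 0 <= T i by rewrite -ler0c TE.
have be0 j : 0 <= be j by rewrite -ler0c beE.
pose u i := col i U; pose v i := col i (V^t* ).
have V'u : V^t* \is unitarymx by rewrite trmxC_unitary.
have u1 i : form 1%:M (u i) (u i) = 1 by exact: form1_col.
have v1 i : form 1%:M (v i) (v i) = 1 by exact: form1_col.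
(* [f j w] is the coefficient of the [j]-th eigenvalue of [B] in the form of [hadamard A B] at
   [w]. *)
pose f j w := complex.Re (form A (row_scale W j w) (row_scale W j w)).
have fE j w : (f j w)%:C = form A (row_scale W j w) (row_scale W j w).
  exact: psd_form_real.
have f0 j w : 0 <= f j w by rewrite -ler0c fE; case: Ap.
have hadE w : form (hadamard A B) w w = (\sum_j be j * f j w)%:C.
  rewrite BE form_hadamard_spectral rmorph_sum; apply: eq_bigr => j _.
  by rewrite rmorphM /= beE fE.
have rowf w : form 1%:M w w = 1 -> \sum_j f j w <= a.
  move=> w1; rewrite -lecR.
  have -> : (\sum_j f j w)%:C = \sum_j form A (row_scale W j w) (row_scale W j w).
    by rewrite rmorph_sum; apply: eq_bigr => j _; exact: fE.
  exact: (sum_row_scale_le Wu w1 Aa).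
have colf (Z : 'M[C]_n) j : Z \is unitarymx -> \sum_i f j (col i Z) <= a.
  move=> Zu; rewrite -lecR.
  (* The entrywise product is symmetric in [W] and [Z] up to transposition, so a column sum becomes
     a row sum for the unitary [Z^T] at a unit vector. *)
  have E i : row_scale W j (col i Z) = row_scale Z^T i (col j W^T).
    by apply/colP => k; rewrite !mxE mulrC.
  have -> : (\sum_i f j (col i Z))%:C =
      \sum_i form A (row_scale Z^T i (col j W^T)) (row_scale Z^T i (col j W^T)).
    by rewrite rmorph_sum; apply: eq_bigr => i _; rewrite -E; exact: fE.
  have Z'u : Z^T \is unitarymx by rewrite trmx_unitary.
  have W'u : W^T \is unitarymx by rewrite trmx_unitary.
  have w1 := form1_col j W'u.
  exact: (sum_row_scale_le Z'u w1 Aa).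
(* The mean over the two singular vectors comes from the mean in the form bound; dividing by [a]
   normalises row and column sums. *)
pose M i j := (f j (u i) + f j (v i)) / (2 * a).
have a2 : 0 < 2 * a by rewrite mulr_gt0.
have M0 i j : 0 <= M i j by rewrite divr_ge0 ?addr_ge0// ltW.
have rowM i : \sum_j M i j <= 1.
  rewrite -mulr_suml big_split ler_pdivrMr// mul1r mulr_natl mulr2n.
  exact: lerD (rowf _ (u1 i)) (rowf _ (v1 i)).
have colM j : \sum_i M i j <= 1.
  rewrite -mulr_suml big_split ler_pdivrMr// mul1r mulr_natl mulr2n.
  exact: lerD (colf _ j Uu) (colf _ j V'u).
pose S i := \sum_j M i j * be j.
have S0 i : 0 <= S i by apply: sumr_ge0 => j _; rewrite mulr_ge0.
have TS i : T i <= K * a * S i + d.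
  rewrite -lecR TE -[t 0 i]ger0_norm//.
  have -> : t 0 i = form (Q + d%:C%:M) (v i) (u i).
    have := form_mx (U^t* ) (Q + d%:C%:M) (V^t* ) i i.
    rewrite trmxCK => <-; rewrite QE !mulmxA unitarymx_tCmul// mul1mx.
    by rewrite -mulmxA (unitarymxP Vu) mulmx1 mxE eqxx.
  rewrite formDm -scalemx1 formZm rmorphD; apply: le_trans (ler_normD _ _) _.
  apply: lerD.
    apply: le_trans (QK _ _) _; rewrite !hadE -rmorphD.
    have -> : (2^-1 : C) = (2^-1)%:C by rewrite rmorphV ?unitfE ?pnatr_eq0// rmorph_nat.
    rewrite -!rmorphM lecR -mulrA ler_pM2l// /S -big_split !mulr_sumr.
    rewrite le_eqVlt; apply/orP; left; apply/eqP; apply: eq_bigr => j _ /=.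
    rewrite /M; move: (f j _) (f j _) (be j) (lt0r_neq0 a0).
    by move=> x y z; clear -R => an0; field.
  rewrite normrM -[leRHS]mulr1 ger0_norm ?ler0c ?(ltW d0)//.
  rewrite ler_wpM2l ?ler0c ?(ltW d0)//; apply: le_trans (psd_le_mean _ _ psd1) _.
  by rewrite u1 v1 -[1 + 1]/(2%:R) mulVf// pnatr_eq0.
have NQd : N (Q + d%:C%:M) <= K * a * N B + d * N 1%:M.
  rewrite QE (hui _ Uu Vu); have -> : diag_mx t = diagr T.
    by congr diag_mx; apply/rowP => i; rewrite mxE TE.
  (* Monotonicity passes to the bound on the singular values, the triangle inequality splits off the
     part with [d], and the substochastic bound compares [S] with the eigenvalues of [B]. *)
  apply: le_trans (diagr_mono hN hui (b := fun i => K * a * S i + d) _) _.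
    by move=> i; rewrite T0 TS.
  have -> : diagr (fun i => K * a * S i + d) =
      (K * a)%:C *: diagr S + d%:C *: (1%:M : 'M[C]_n).
    apply/matrixP => i j; rewrite !mxE rmorphD rmorphM.
    by case: (i == j); rewrite ?mulr0n ?mulr0 ?addr0// !mulr1n mulr1.
  apply: le_trans (norm_triangle hN _ _) _.
  rewrite !norm_real_scale ?(ltW d0) ?mulr_ge0 ?(ltW K0) ?(ltW a0)//.
  rewrite lerD2r ler_pM2l ?mulr_gt0//.
  have -> : N B = N (diagr be).
    have W'u : W^t* \is unitarymx by rewrite trmxC_unitary.
    rewrite BE (hui _ W'u Wu); congr N; congr diag_mx.
    by apply/rowP => j; rewrite mxE beE.
  exact: (diagr_le_substochastic hN hui S0 be0 M0 rowM colM).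
have NQ : N Q <= N (Q + d%:C%:M) + d * N 1%:M.
  have QE' : Q = (Q + d%:C%:M) + (- d)%:C *: 1%:M.
    by rewrite -(scalemx1 _ d%:C) -addrA -scalerDl -rmorphD subrr scale0r addr0.
  rewrite {1}QE'; apply: le_trans (norm_triangle hN _ _) _.
  by rewrite (norm_scale hN _ 1%:M) modulus_real normrN gtr0_norm.
have dN : d * (2 * (N 1%:M + 1)) <= e by rewrite -ler_pdivlMr// mulr_gt0// ltr_wpDl.
by lra.
Qed.
End NormBound.

(** * The generalized numerical radius *)

Section NumericalRadius.
Variables (R : realType) (n : nat) (N : 'M[R[i]]_n -> R).
Hypotheses (hN : is_norm N) (hui : norm_unitarily_invariant N).
Hypothesis hsa : norm_selfadjoint N.
Local Notation C := R[i].
Implicit Types (X Y : 'M[C]_n) (z : C).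

Lemma modulusM (z w : C) : modulus (z * w) = modulus z * modulus w.
Proof. exact: ComplexField.Normc.normcM. Qed.

Lemma le_Re_modulus z : complex.Re z <= modulus z.
Proof.
apply: le_trans (ler_norm _) _.
have h : (`|complex.Re z|)%:C <= (modulus z)%:C := normc_ge_Re z.
by rewrite -lecR.
Qed.

Lemma modulus_expi (t : R) : modulus (expi t) = 1.
Proof. by rewrite /modulus /= cos2Dsin2 sqrtr1. Qed.

(** The angle is [acos x] up to sign, the sign being that of the imaginary part. *)
Lemma modulus1_expi z : modulus z = 1 -> exists t : R, z = expi t.
Proof.
case: z => x y; rewrite /modulus /= => xy1.
have {xy1} xy : x ^+ 2 + y ^+ 2 = 1.
  by rewrite -[LHS]sqr_sqrtr ?xy1 ?expr1n// addr_ge0 ?sqr_ge0.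
have x1 : -1 <= x <= 1.
  rewrite -ler_norml -(@expr_le1 _ 2)// -normrX ger0_norm ?sqr_ge0//.
  by rewrite -xy lerDl sqr_ge0.
have cosx : cos (acos x) = x by rewrite acosK.
have sinx : sin (acos x) = `|y|.
  by rewrite sin_acos// -xy addrAC subrr add0r sqrtr_sqr.
have [y0|y0] := leP 0 y.
  by exists (acos x); rewrite /expi cosx sinx ger0_norm.
by exists (- acos x); rewrite /expi cosN sinN cosx sinx ltr0_norm// opprK.
Qed.

Lemma norm_remx_le X : N (remx X) <= N X.
Proof.
have -> : remx X = (2^-1 : R)%:C *: (X + X^t* ).
  by rewrite /remx rmorphV ?unitfE ?pnatr_eq0// rmorph_nat.
rewrite norm_real_scale ?invr_ge0// mulrC ler_pdivrMr//.
by apply: le_trans (norm_triangle hN _ _) _; rewrite hsa mulr_natr mulr2n.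
Qed.

Lemma norm_remx_expi_le X (t : R) : N (remx (expi t *: X)) <= N X.
Proof.
apply: le_trans (norm_remx_le _) _.
by rewrite (norm_scale hN) modulus_expi mul1r.
Qed.

Lemma numradius_le_norm X : gen_numradius N X <= N X.
Proof.
apply: ge_sup; first by exists (N (remx (expi 0 *: X))), 0.
by move=> _ [t _ <-]; exact: norm_remx_expi_le.
Qed.

Lemma norm_remx_le_numradius X z : modulus z = 1 ->
  N (remx (z *: X)) <= gen_numradius N X.
Proof.
move=> /modulus1_expi[t ->]; apply: ub_le_sup; last by exists t.
by exists (N X) => _ [s _ <-]; exact: norm_remx_expi_le.
Qed.

Lemma diag_form X i : X i i = form X (col i 1%:M) (col i 1%:M).
Proof. by have := form_mx 1%:M X 1%:M i i; rewrite mul1mx mulmx1 trmx1 map_mx1. Qed.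

Lemma remx_diag X i : remx X i i = (complex.Re (X i i))%:C.
Proof. by rewrite diag_form form_remx -diag_form. Qed.

Lemma sector_diag (a : R) X i : numrange X `<=` sector a -> 0 < complex.Re (X i i).
Proof.
move=> Xa; rewrite diag_form.
have e0 : col i (1%:M : 'M[C]_n) != 0.
  apply/eqP => /colP/(_ i); rewrite !mxE eqxx => /eqP; exact/negP/oner_neq0.
by have [] := numrange_sector_form Xa e0.
Qed.

Lemma le_maxdiag X i : modulus (X i i) <= maxdiag X.
Proof. exact: (le_bigmax _ (fun j => modulus (X j j))). Qed.

Lemma sec_gt0 (a : R) : 0 <= a < pi / 2 -> 0 < sec a.
Proof.
move=> /andP[a0 api]; rewrite invr_gt0 cos_gt0_pihalf// api andbT.
by rewrite (lt_le_trans _ a0)// oppr_lt0 divr_gt0 ?pi_gt0.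
Qed.

Lemma numradius_hadamard_le (a1 a2 : R) X Y : (1 <= n)%N ->
    0 <= a1 < pi / 2 -> 0 <= a2 < pi / 2 -> sectorial a1 X -> sectorial a2 Y ->
  gen_numradius N (hadamard X Y)
    <= sec a1 * sec a2 * maxdiag X * gen_numradius N Y.
Proof.
move=> n0 a1P a2P [z [z1 Xa]] [w [w1 Yb]].
have s1 := sec_gt0 a1P; have s2 := sec_gt0 a2P.
have [P1 [P2 [x1 [x2 [[pP1 pP2] x11 x21 XE PE]]]]] := sector_decomposition a1P Xa.
have [Q1 [Q2 [y1 [y2 [[pQ1 pQ2] y11 y21 YE QE]]]]] := sector_decomposition a2P Yb.
have ReX i : complex.Re ((z *: X) i i) <= maxdiag X.
  apply: le_trans (le_Re_modulus _) _; rewrite mxE modulusM z1 mul1r.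
  exact: le_maxdiag.
(* Since [n >= 1] there is a diagonal entry, and that of [z *: X] has positive real part. *)
have a0 : 0 < maxdiag X.
  exact: lt_le_trans (sector_diag (Ordinal n0) Xa) (ReX _).
have K0 : 0 < sec a1 * sec a2 by rewrite mulr_gt0.
apply: le_trans (numradius_le_norm _) _.
(* The phases that rotate both numerical ranges into their sectors do not change the norm of the
   product. *)
have -> : N (hadamard X Y) = N (hadamard (z *: X) (w *: Y)).
  by rewrite hadamardZl hadamardZr !(norm_scale hN) z1 w1 !mul1r.
apply: (@le_trans _ _ (sec a1 * sec a2 * maxdiag X * N (remx (w *: Y)))).
  have pA := numrange_sector_psd Xa; have pB := numrange_sector_psd Yb.
  apply: (norm_le_of_form hN hui K0 a0 pA pB) => [i|u v].
    by rewrite remx_diag lecR.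
  rewrite {1}XE {1}YE.
  rewrite rmorphM.
  exact: (hadamard_form_le_scaled u v pP1 pP2 pQ1 pQ2 x11 x21 y11 y21 PE QE).
by rewrite ler_pM2l ?mulr_gt0//; exact: norm_remx_le_numradius.
Qed.
End NumericalRadius.

Theorem theorem2p5 (R : realType) (n : nat) (hn : (1 <= n)%N)
    (N : 'M[R[i]]_n -> R) (hN : is_norm N)
    (hmul : norm_multiplicative N) (hui : norm_unitarily_invariant N)
    (hsa : norm_selfadjoint N)
    (a1 a2 : R) (ha1 : 0 <= a1 < pi / 2) (ha2 : 0 <= a2 < pi / 2)
    (X Y : 'M[R[i]]_n) (hX : sectorial a1 X) (hY : sectorial a2 Y) :
  gen_numradius N (hadamard X Y)
    <= sec a1 * sec a2 * maxdiag X * gen_numradius N Y /\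
  gen_numradius N (hadamard X Y)
    <= sec a1 * sec a2 * maxdiag Y * gen_numradius N X.
Proof.
split; first exact: numradius_hadamard_le.
by rewrite hadamardC [sec a1 * _]mulrC; exact: numradius_hadamard_le.
Qed.
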